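(* Let $\mathbb{K}$ be an arbitrary field and let $A$ be an arbitrary algebra over $\mathbb{K}$ (of arbitrary dimension, with no identity assumed for its product). Then $A$ is simple if and only if ${\rm Ann}(A)=0$ and $A$ admits an $i$-division basis.
   Context: An algebra over a field $\mathbb{K}$ is a $\mathbb{K}$-vector space $A$ (of arbitrary, possibly infinite, dimension) endowed with a bilinear map $A\times A\to A$, $(x,y)\mapsto xy$, called the product; no identity (associativity, commutativity, Jacobi, existence of a unit, etc.) is assumed. Ideals are two-sided: an ideal is a linear subspace $I\subset A$ with $IA\subset I$ and $AI\subset I$. For $c\in A$, $\mathcal{I}(c)$ denotes the ideal of $A$ generated by $c$. The algebra $A$ is simple if its product is non-zero and its only ideals are $\{0\}$ and $A$. The annihilator of $A$ is the ideal ${\rm Ann}(A)=\{x\in A: xA=Ax=0\}$. A linear basis $\mathcal{B}=\{e_i\}_{i\in I}$ of $A$ is an $i$-division basis if for any $e_i\in\mathcal{B}$ and any $x\in A$ such that $0\neq e_ix=c$ or $0\neq xe_i=c$, we have $e_i,x\in\mathcal{I}(c)$. (Here the ''$i$'' in ''$i$-division'' is part of the name, not an index.)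
   Formalization: The algebra A is assumed non-zero; for A = 0 the annihilator is zero and the empty basis is vacuously an i-division basis, but the product is zero, so A is not simple and the equivalence fails. *)

(* Defs.v *)
From HB Require Import structures.
From mathcomp Require Import all_boot all_order all_algebra.
From mathcomp Require Import boolp classical_sets.

Set Implicit Arguments.
Unset Strict Implicit.
Unset Printing Implicit Defensive.

Import GRing.Theory.
Local Open Scope classical_set_scope.
Local Open Scope ring_scope.

Section Algebra.
Variables (K : fieldType) (A : lmodType K).

(* Linear combinations are finite sums over duplicate-free sequences of vectors
   of [B]; the coefficient function [a] matters only on the sequence. *)
Definition linearly_independent (B : set A) : Prop :=
  forall (s : seq A) (a : A -> K), uniq s -> [set` s] `<=` B ->
    \sum_(v <- s) a v *: v = 0 -> forall v, v \in s -> a v = 0.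

Definition spanning (B : set A) : Prop :=
  forall x : A, exists (s : seq A) (a : A -> K),
    [/\ uniq s, [set` s] `<=` B & x = \sum_(v <- s) a v *: v].

Definition linear_basis (B : set A) : Prop :=
  linearly_independent B /\ spanning B.

Variable mul : {bilinear A -> A -> A}.

Definition ideal (I : set A) : Prop :=
  [/\ GRing.submod_closed (mem I),
      forall x y, I x -> I (mul x y)
    & forall x y, I x -> I (mul y x)].

Definition ideal_generated (c : A) : set A := smallest ideal [set c].

Definition simple_algebra : Prop :=
  (exists x y : A, mul x y != 0) /\
  (forall I : set A, ideal I -> I = [set 0] \/ I = [set: A]).

Definition annihilator : set A :=
  [set x | forall y, mul x y = 0 /\ mul y x = 0].

Definition i_division_basis (B : set A) : Prop :=
  linear_basis B /\
  forall e x c : A, B e -> c != 0 -> mul e x = c \/ mul x e = c ->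
    ideal_generated c e /\ ideal_generated c x.

End Algebra.

(* Main.v *)
(** Independence is of finite character, so Zorn's lemma gives every vector
    space a basis; in a simple algebra [I(c)] is everything for [c <> 0], hence
    every basis is an i-division basis.

    Conversely, if a non-zero ideal [I] contains [x <> 0], then [Ann(A) = 0]
    gives a basis element [e] with, say, [e x <> 0], so [e] lies in [I(e x)],
    hence in [I]. For any [y], either [e y <> 0] and [y] lies in [I(e y)], or
    [e (x + y) = e x] and both [x + y] and [x] lie in [I(e x)]; so [I = A]. *)
Require Import Defs.
From HB Require Import structures.
From mathcomp Require Import all_boot all_order all_algebra.
From mathcomp Require Import boolp classical_sets.

Import GRing.Theory.
Local Open Scope classical_set_scope.
Local Open Scope ring_scope.

(** This is how finite character enters: by induction, the larger of a member containing [x] and a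
    member containing the rest contains both. The list is non-empty because [F] may be empty. *)
Lemma chain_finite_subset (T : choiceType) (F : set (set T)) (x : T) (s : seq T) :
  total_on F subset -> [set` x :: s] `<=` \bigcup_(X in F) X ->
  exists2 X, F X & [set` x :: s] `<=` X.
Proof.
move=> Ftot; elim: s x => [|y s IHs] x sub.
  have [X FX Xx] := sub x (mem_head _ _).
  by exists X => // z; rewrite /= inE => /eqP ->.
have [X FX Xx] := sub x (mem_head _ _).
have [|Y FY Ys] := IHs y.
  by move=> z zs; apply: sub; rewrite /= inE [z \in _]zs orbT.
have [XY|YX] := Ftot _ _ FX FY.
  exists Y => // z; rewrite /= inE => /predU1P[->|]; [exact: XY | exact: Ys].
by exists X => // z; rewrite /= inE => /predU1P[->//|zs]; apply/YX/Ys.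
Qed.

Section Bases.
Variables (K : fieldType) (A : lmodType K).

(** A vector [x] outside the span of [B] could be adjoined: a relation in the enlarged set either
    has coefficient zero at [x], and is then a relation in [B], or can be solved for [x]. *)
Lemma maximal_independent_spanning (B : set A) :
  linearly_independent B ->
  (forall C, B `<` C -> ~ linearly_independent C) -> spanning B.
Proof.
move=> Bind Bmax x; apply: contrapT => xB.
have nBx : ~ B x.
  move=> Bx; apply: xB; exists [:: x], (fun=> 1); split=> //.
    by move=> z; rewrite /= inE => /eqP ->.
  by rewrite big_seq1 scale1r.
apply: (Bmax (B `|` [set x])).
  by split=> [|/(_ x) sub]; [exact: subsetUl | apply: nBx; apply: sub; right].
move=> s a us sub s0.
have sB (t : seq A) : {subset t <= s} -> x \notin t -> [set` t] `<=` B.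
  by move=> ts xt z /= zt; case: (sub z (ts z zt)) => // /= zx; rewrite -zx zt in xt.
have [xs|xs] := boolP (x \in s); last exact: (Bind s a us (sB s _ xs) s0).
have remB : [set` rem x s] `<=` B.
  by apply: sB; [exact: mem_rem | rewrite mem_rem_uniq // !inE eqxx].
have := s0; rewrite (perm_big _ (perm_to_rem xs)) big_cons /= => sum0.
have [ax0|ax0] := eqVneq (a x) 0.
  move: sum0; rewrite ax0 scale0r add0r => sum0 v vs.
  have [->//|vx] := eqVneq v x.
  apply: (Bind _ a (rem_uniq _ us) remB sum0).
  by rewrite mem_rem_uniq // !inE vx.
(* Solving the relation for [x], whose coefficient [a x] is invertible, gives these coefficients. *)
case: xB; exists (rem x s), (fun v => - (a x)^-1 * a v); split=> //.
  exact: rem_uniq.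
rewrite (eq_bigr (fun v => - (a x)^-1 *: (a v *: v))); last first.
  by move=> v _; rewrite scalerA.
rewrite -scaler_sumr; move/eqP: sum0; rewrite addrC addr_eq0 => /eqP ->.
by rewrite scaleNr scalerN opprK scalerA mulVf // scale1r.
Qed.

Lemma linear_basis_exists : exists B : set A, linear_basis B.
Proof.
have [|B [Bind Bmax]] := @Zorn_bigcup _ (@linearly_independent K A).
  (* Independence on the empty sequence is vacuous, which also covers the empty chain. *)
  move=> F Find Ftot [|x s] a us sub s0 //.
  have [X FX Xs] := chain_finite_subset _ _ _ _ Ftot sub.
  exact: (Find X FX _ a us Xs s0).
by exists B; split=> //; apply: maximal_independent_spanning => // C /Bmax.
Qed.

Lemma spanning_linear_eq0 (V : lmodType K) (f : {linear A -> V}) (B : set A) :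
  spanning B -> (forall e, B e -> f e = 0) -> forall x, f x = 0.
Proof.
move=> Bspan fB x; have [s [a [_ sB ->]]] := Bspan x.
rewrite linear_sum big_seq big1 // => v vs.
by rewrite linearZ (fB v (sB v vs)) /= scaler0.
Qed.

End Bases.

Section Ideals.
Variables (K : fieldType) (A : lmodType K) (mul : {bilinear A -> A -> A}).

Lemma ideal0 (I : set A) : ideal mul I -> I 0.
Proof. by case=> -[] /set_mem. Qed.

Lemma idealD (I : set A) x y : ideal mul I -> I x -> I y -> I (x + y).
Proof.
case=> -[_ Ilin] _ _ Ix Iy; rewrite -[x]scale1r.
by apply/set_mem/Ilin; apply: mem_set.
Qed.

Lemma idealN (I : set A) x : ideal mul I -> I x -> I (- x).
Proof.
move=> Iid Ix; have I0 := ideal0 _ Iid; case: Iid => -[_ Ilin] _ _.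
(* [submod_closed] speaks only of zero and of combinations [a *: u + v], so [- x] becomes
   [-1 *: x + 0]. *)
rewrite -scaleN1r -[_ *: _]addr0.
by apply/set_mem/Ilin; apply: mem_set.
Qed.

Lemma ideal_generated_ideal (c : A) : ideal mul (ideal_generated mul c).
Proof.
split.
- split=> [|k x y /set_mem Ix /set_mem Iy]; apply/mem_set => I [Iid cI].
    exact: ideal0.
  have [[_ Ilin] _ _] := Iid.
  by apply/set_mem/Ilin; apply/mem_set; [apply: Ix | apply: Iy].
- by move=> x y Ix I [Iid cI]; have [_ + _] := Iid; apply; apply: Ix.
- by move=> x y Ix I [Iid cI]; have [_ _] := Iid; apply; apply: Ix.
Qed.

Lemma ideal_generated_self (c : A) : ideal_generated mul c c.
Proof. by move=> I [_]; apply. Qed.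

Lemma ideal_generated_sub (I : set A) (c : A) :
  ideal mul I -> I c -> ideal_generated mul c `<=` I.
Proof. by move=> Iid Ic x; apply; split=> // _ ->. Qed.

Lemma annihilator_ideal : ideal mul (annihilator mul).
Proof.
split.
- split=> [|k x y /set_mem Ax /set_mem Ay]; apply/mem_set => z.
    by rewrite linear0l linear0r.
  have [xz zx] := Ax z; have [yz zy] := Ay z.
  by rewrite linearPl linearPr xz zx yz zy !scaler0 !addr0.
- by move=> x y Ax z; rewrite (Ax y).1 linear0l linear0r.
- by move=> x y Ax z; rewrite (Ax y).2 linear0l linear0r.
Qed.

(** The annihilator is an ideal, and it cannot be all of [A] since the product is non-zero. *)
Lemma simple_annihilator : simple_algebra mul -> annihilator mul = [set 0].
Proof.
move=> [[x [y xy]] /(_ _ annihilator_ideal)[//|annT]].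
have : annihilator mul x by rewrite annT.
by move=> /(_ y)[xy0]; rewrite xy0 eqxx in xy.
Qed.

Lemma simple_ideal_generated (c : A) :
  simple_algebra mul -> c != 0 -> ideal_generated mul c = [set: A].
Proof.
move=> [_ /(_ _ (ideal_generated_ideal c))[I0|//]] c0.
have := ideal_generated_self c.
by rewrite I0 => /= ce; rewrite ce eqxx in c0.
Qed.

(** Left and right multiplication by [x] are linear maps, so it suffices that they vanish on [B]. *)
Lemma spanning_annihilator (B : set A) (x : A) :
  spanning B -> (forall e, B e -> mul e x = 0 /\ mul x e = 0) ->
  annihilator mul x.
Proof.
move=> Bspan Bx y; split.
  by apply: (spanning_linear_eq0 _ _ _ (mul x) _ Bspan) => e /Bx[].
pose f : {linear A -> A} := applyr mul x.
by apply: (spanning_linear_eq0 _ _ _ f _ Bspan) => e /Bx[].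
Qed.

(* [f] stands for left or right multiplication by a basis element. *)
Lemma ideal_division (I : set A) (f : {linear A -> A}) (x : A) :
  ideal mul I -> (forall z, I (f z)) ->
  (forall z, f z != 0 -> ideal_generated mul (f z) z) ->
  f x != 0 -> I = [set: A].
Proof.
move=> Iid If fdiv fx0.
have fI z : f z != 0 -> I z.
  by move=> /fdiv; apply: ideal_generated_sub.
apply/seteqP; split=> // y _.
have [fy0|/fI//] := eqVneq (f y) 0.
(* Here [y = - x + (x + y)], and [f] takes the same non-zero value at [x] and at [x + y]. *)
rewrite -[y](addKr x); apply: idealD => //; first by apply: idealN => //; apply: fI.
by apply: fI; rewrite linearD fy0 addr0.
Qed.

Lemma i_division_ideal (B : set A) (I : set A) (x : A) :
  annihilator mul = [set 0] -> i_division_basis mul B ->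
  ideal mul I -> I x -> x != 0 -> I = [set: A].
Proof.
move=> ann0 [[_ Bspan] Bdiv] Iid Ix x0.
have [_ Ir Il] := Iid.
have [e Be ex] : exists2 e, B e & mul e x != 0 \/ mul x e != 0.
  apply: contrapT => nB; move/eqP: x0; apply.
  suff: annihilator mul x by rewrite ann0.
  apply: spanning_annihilator Bspan _ => e Be.
  by split; apply/eqP/negPn/negP => ne; apply: nB; exists e => //; [left | right].
have Ie : I e.
  case: ex => ne.
    have [+ _] := Bdiv e x _ Be ne (or_introl erefl).
    by apply: ideal_generated_sub => //; apply: Il.
  have [+ _] := Bdiv e x _ Be ne (or_intror erefl).
  by apply: ideal_generated_sub => //; apply: Ir.
(* Since [e] lies in [I], so does every value of multiplication by [e] on either side; the side that
   does not kill [x] serves as [f] in [ideal_division]. *)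
case: ex => ne.
  apply: (ideal_division I (mul e) x) => // z; first exact: Ir.
  by move=> nz; have [] := Bdiv e z _ Be nz (or_introl erefl).
pose f : {linear A -> A} := applyr mul e.
apply: (ideal_division I f x) => // z; first exact: Il.
by move=> nz; have [] := Bdiv e z _ Be nz (or_intror erefl).
Qed.

End Ideals.

(** [A_neq0] excludes the zero space: its annihilator is zero and its empty basis is an i-division
    basis, yet its product is zero. *)
Theorem corollary1 (K : fieldType) (A : lmodType K)
    (mul : {bilinear A -> A -> A}) (A_neq0 : exists x : A, x != 0) :
  simple_algebra mul <->
  (annihilator mul = [set 0] /\ exists B : set A, i_division_basis mul B).
Proof.
split=> [Asimple | [ann0 [B Bdiv]]].
  split; first exact: simple_annihilator.
  have [B Bbasis] := linear_basis_exists K A.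
  by exists B; split=> // e x c _ c0 _; rewrite simple_ideal_generated.
split=> [|I Iid].
  (* A zero product would put every vector, in particular a non-zero one, into the annihilator. *)
  apply: contrapT => mul0; have [x /eqP] := A_neq0; apply.
  suff: annihilator mul x by rewrite ann0.
  have mulE u v : mul u v = 0.
    by apply/eqP/negPn/negP => uv; apply: mul0; exists u, v.
  by move=> y; rewrite !mulE.
have [I0|] := pselect (I `<=` [set 0]).
  left; apply/seteqP; split=> // _ ->; exact: ideal0 Iid.
move=> /existsNP[x /not_implyP[Ix /eqP x0]]; right.
exact: i_division_ideal ann0 Bdiv Iid Ix x0.
Qed.
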